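(* For every $n\in\mathbb N$ with $n>1$, the matricially normed space $\widehat M_n$ is not an $L^1$-space.
   Context: All linear spaces are complex. $M_n$ is the linear space of $n\times n$ complex matrices, $\|\cdot\|_o$ the operator norm on it. For a linear space $E$, $M_n(E)$ is the space of $n\times n$ matrices with entries in $E$; $u_1\oplus\dots\oplus u_k$ denotes the block-diagonal matrix with blocks $u_1,\dots,u_k$. The closed unit ball of a normed space $X$ is $B_X$. A matrix-norm on $E$ is a sequence of norms $\|\cdot\|_n$ on $M_n(E)$, $n\in\mathbb N$, such that (Axiom 1) $\|u\oplus 0\|_{n+m}=\|u\|_n$ for $u\in M_n(E)$ and $0\in M_m(E)$; (Axiom 2) $\|Su\|_n\le\|S\|_o\|u\|_n$ and $\|uS\|_n\le\|u\|_n\|S\|_o$ for $u\in M_n(E)$, $S\in M_n$. A matricially normed space is a linear space with a matrix-norm. For a linear operator $\varphi:E\to F$, its $m$-th amplification is $\varphi_m:M_m(E)\to M_m(F)$, $(x_{ij})\mapsto(\varphi(x_{ij}))$. The space $\widehat M_n$: for a linear space $E$ and $v=(x_{ij})\in M_n(E)$ let $\varphi^v:M_n\to E$, $(\lambda_{ij})\mapsto\sum_{i,j}\lambda_{ji}x_{ij}$. $\widehat M_n$ is $M_n$ with the matrix-norm given on $u\in M_m(M_n)$ by $\|u\|_m:=\sup\|(\varphi^v)_m(u)\|_m$, the supremum taken over all pairs $(E,v)$ with $E$ a matricially normed space and $v\in B_{M_n(E)}$. A matricially normed space $E$ is an $L^1$-space if for all finite families of square matrices $u_1,\dots,u_k$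 (of possibly different sizes) with entries in $E$ one has $\|u_1\oplus\dots\oplus u_k\|=\sum_{i=1}^k\|u_i\|$. *)

(* Defs.v *)
From HB Require Import structures.
From mathcomp Require Import all_boot all_order all_algebra.
From mathcomp Require Import mathcomp_extra boolp classical_sets reals.
From mathcomp Require Import complex ring.

Set Implicit Arguments.
Unset Strict Implicit.
Unset Printing Implicit Defensive.

Import Order.TTheory GRing.Theory Num.Theory.
Local Open Scope classical_set_scope.
Local Open Scope ring_scope.

(* The complex numbers are [R[i]] for R : realType.
   [Normc.normc z] is the modulus of z : R[i] as an element of R, whereas
   [`|z|] lives in R[i]. *)
Notation modulus := Normc.normc.

Definition l2norm (R : realType) (n : nat) (x : 'cV[R[i]]_n) : R :=
  Num.sqrt (\sum_i modulus (x i ord0) ^+ 2).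

Definition opnorm (R : realType) (n : nat) (S : 'M[R[i]]_n) : R :=
  sup [set r | exists2 x : 'cV[R[i]]_n, l2norm x <= 1 & r = l2norm (S *m x)].

(* Products of a scalar matrix with a matrix over a linear space; [*m] only
   applies when both factors have entries in the same ring. *)
Definition lmulmx (K : pzRingType) (E : lmodType K) (n : nat)
    (S : 'M[K]_n) (u : 'M[E]_n) : 'M[E]_n :=
  \matrix_(i, j) \sum_k S i k *: u k j.

Definition rmulmx (K : pzRingType) (E : lmodType K) (n : nat)
    (u : 'M[E]_n) (S : 'M[K]_n) : 'M[E]_n :=
  \matrix_(i, j) \sum_k S k j *: u i k.

(* Size 0 is allowed: [matrix_norm_eq0]-[matrix_normZ] force the norm on
   'M[E]_0 to be 0, and the other axioms are then trivial for that size. *)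
Record is_matrix_norm (R : realType) (E : lmodType R[i])
    (N : forall n, 'M[E]_n -> R) : Prop := IsMatrixNorm {
  matrix_norm_eq0 : forall n (u : 'M[E]_n), N n u = 0 -> u = 0;
  matrix_normZ : forall n (a : R[i]) (u : 'M[E]_n),
    N n (map_mx ( *:%R a) u) = modulus a * N n u;
  matrix_normD : forall n (u w : 'M[E]_n), N n (u + w) <= N n u + N n w;
  matrix_norm_dsum0 : forall n m (u : 'M[E]_n),
    N (n + m)%N (block_mx u 0 0 (0 : 'M[E]_m)) = N n u;
  matrix_norm_lmul : forall n (S : 'M[R[i]]_n) (u : 'M[E]_n),
    N n (lmulmx S u) <= opnorm S * N n u;
  matrix_norm_rmul : forall n (S : 'M[R[i]]_n) (u : 'M[E]_n),
    N n (rmulmx u S) <= N n u * opnorm S }.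

Record matNormedSpace (R : realType) := MatNormedSpace {
  mns_sort :> lmodType R[i];
  mnorm : forall n, 'M[mns_sort]_n -> R;
  mnormP : is_matrix_norm mnorm }.
Arguments mnorm {R} E {n} u : rename.

Definition is_L1_space (R : realType) (E : matNormedSpace R) : Prop :=
  forall (k : nat) (p : 'I_k -> nat) (u : forall i, 'M[E]_(p i)),
    mnorm E (\mxdiag_i u i) = \sum_i mnorm E (u i).

(* Note the transposition: the coefficient of [v i j] is [l j i]. *)
Definition phi (K : pzRingType) (E : lmodType K) (n : nat) (v : 'M[E]_n)
    (l : 'M[K]_n) : E :=
  \sum_i \sum_j l j i *: v i j.

(* The m-th amplification of a map f is [map_mx f].  This set is nonempty and
   bounded above ([hat_set_has_sup]), so the real [sup] below is genuine. *)
Definition hat_set (R : realType) (n m : nat) (u : 'M['M[R[i]]_n]_m) : set R :=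
  [set r | exists (E : matNormedSpace R) (v : 'M[E]_n),
     mnorm E v <= 1 /\ r = mnorm E (map_mx (phi v) u)].

Definition hat_norm (R : realType) (n m : nat) (u : 'M['M[R[i]]_n]_m) : R :=
  sup (hat_set u).

Section L2norm.
Variable R : realType.
Local Notation C := R[i].

Let modulus_ge0 (z : C) : 0 <= modulus z.
Proof. by case: z => a b /=; exact: sqrtr_ge0. Qed.

Lemma cauchy_schwarz (I : finType) (a b : I -> R) :
  \sum_i a i * b i <=
  Num.sqrt (\sum_i a i ^+ 2) * Num.sqrt (\sum_i b i ^+ 2).
Proof.
have sq_ge0 (c : I -> R) : 0 <= \sum_i c i ^+ 2.
  by apply: sumr_ge0 => i _; exact: sqr_ge0.
rewrite -sqrtrM //; set A := \sum_i a i ^+ 2; set B := \sum_i b i ^+ 2.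
set D := \sum_i a i * b i.
have [D0|D0] := ltP D 0.
  by apply: le_trans (ltW D0) (sqrtr_ge0 _).
rewrite -[D](ger0_norm D0) -sqrtr_sqr ler_sqrt ?mulr_ge0 // ?sq_ge0 //.
have [B0|B0] := eqVneq B 0.
  have b0 i : b i = 0.
    move/eqP: B0; rewrite psumr_eq0; last by move=> j _; exact: sqr_ge0.
    by move=> /allP/(_ i (mem_index_enum _)); rewrite sqrf_eq0 => /eqP.
  suff -> : D = 0 by rewrite expr0n /= mulr_ge0 // sq_ge0.
  by apply: big1 => i _; rewrite b0 mulr0.
have Bp : 0 < B by rewrite lt_def B0 sq_ge0.
have : 0 <= \sum_i (B * a i - D * b i) ^+ 2 by exact: sq_ge0.
have -> : \sum_i (B * a i - D * b i) ^+ 2 = B * (A * B - D ^+ 2).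
  transitivity (\sum_i (B ^+ 2 * a i ^+ 2 - (B * D *+ 2) * (a i * b i)
                        + D ^+ 2 * b i ^+ 2)).
    by apply: eq_bigr => i _; ring.
  rewrite big_split /= sumrB -!mulr_sumr -/A -/B -/D.
  by ring.
by rewrite pmulr_rge0 // subr_ge0.
Qed.

Lemma l2norm_ge0 n (x : 'cV[C]_n) : 0 <= l2norm x.
Proof. exact: sqrtr_ge0. Qed.

Lemma l2norm_sqr n (x : 'cV[C]_n) :
  l2norm x ^+ 2 = \sum_i modulus (x i ord0) ^+ 2.
Proof. by rewrite sqr_sqrtr //; apply: sumr_ge0 => i _; exact: sqr_ge0. Qed.

Lemma modulus_le_l2norm n (x : 'cV[C]_n) i : modulus (x i ord0) <= l2norm x.
Proof.
rewrite -(ler_pXn2r (n := 2)) // ?nnegrE ?l2norm_ge0 ?modulus_ge0 // l2norm_sqr.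
by rewrite (bigD1 i) //= lerDl; apply: sumr_ge0 => j _; exact: sqr_ge0.
Qed.

Lemma l2norm0 n : l2norm (0 : 'cV[C]_n) = 0.
Proof.
rewrite /l2norm big1 ?sqrtr0 // => i _.
by rewrite mxE Normc.normc0 expr0n.
Qed.

Lemma l2norm_eq0 n (x : 'cV[C]_n) : l2norm x = 0 -> x = 0.
Proof.
move=> x0; apply/matrixP => i j; rewrite ord1 mxE.
apply: Normc.eq0_normc; apply/eqP; rewrite eq_le modulus_ge0 andbT.
by rewrite -x0 modulus_le_l2norm.
Qed.

Lemma l2normZ n (a : C) (x : 'cV[C]_n) : l2norm (a *: x) = modulus a * l2norm x.
Proof.
rewrite /l2norm -[modulus a]ger0_norm ?modulus_ge0 // -sqrtr_sqr.
rewrite -sqrtrM ?sqr_ge0 // mulr_sumr; congr Num.sqrt; apply: eq_bigr => i _.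
by rewrite mxE Normc.normcM exprMn.
Qed.

Lemma l2normD n (x y : 'cV[C]_n) : l2norm (x + y) <= l2norm x + l2norm y.
Proof.
rewrite -(ler_pXn2r (n := 2)) // ?nnegrE ?addr_ge0 ?l2norm_ge0 //.
rewrite sqrrD !l2norm_sqr.
pose a i := modulus (x i ord0); pose b i := modulus (y i ord0).
apply: (@le_trans _ _ (\sum_i (a i + b i) ^+ 2)).
  apply: ler_sum => i _; rewrite mxE.
  rewrite ler_pXn2r ?nnegrE ?addr_ge0 ?modulus_ge0 //.
  exact: (le_normcD (x i ord0) (y i ord0)).
under eq_bigr do rewrite sqrrD.
rewrite 2!big_split /= lerD2r lerD2l sumrMnl lerMn2r /=.
exact: (cauchy_schwarz a b).
Qed.

Lemma l2norm_sum n (I : Type) (s : seq I) (F : I -> 'cV[C]_n) :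
  l2norm (\sum_(i <- s) F i) <= \sum_(i <- s) l2norm (F i).
Proof.
elim: s => [|i s IH]; first by rewrite !big_nil l2norm0.
rewrite !big_cons; apply: le_trans (l2normD _ _) _.
by rewrite lerD2l.
Qed.

Lemma mul_delta_cV n m (S : 'M[C]_(n, m)) (x : 'cV[C]_m) :
  S *m x = \sum_j x j ord0 *: col j S.
Proof.
apply/matrixP => i k; rewrite ord1 !mxE summxE; apply: eq_bigr => j _.
by rewrite !mxE mulrC.
Qed.

Let opset n (S : 'M[C]_n) :=
  [set r | exists2 x : 'cV[C]_n, l2norm x <= 1 & r = l2norm (S *m x)].

Lemma opset_has_sup n (S : 'M[C]_n) : has_sup (opset S).
Proof.
split; first by exists (l2norm (S *m 0)), 0; rewrite ?l2norm0.
exists (\sum_j l2norm (col j S)) => _ [x x1 ->].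
rewrite mul_delta_cV; apply: le_trans (l2norm_sum _ _) _.
apply: ler_sum => j _; rewrite l2normZ ler_piMl ?l2norm_ge0 //.
exact: le_trans (modulus_le_l2norm _ _) x1.
Qed.

Lemma opnorm_ge0 n (S : 'M[C]_n) : 0 <= opnorm S.
Proof.
apply: ub_le_sup; first exact: (opset_has_sup S).2.
by exists 0; rewrite ?mulmx0 ?l2norm0.
Qed.

Lemma opnorm_le n (S : 'M[C]_n) (c : R) : 0 <= c ->
  (forall x, l2norm (S *m x) <= c * l2norm x) -> opnorm S <= c.
Proof.
move=> c0 Sc; apply: ge_sup; first exact: (opset_has_sup S).1.
move=> _ [x x1 ->]; apply: le_trans (Sc x) _.
by rewrite ler_piMr.
Qed.

Lemma modulus_real (a : R) : modulus (a%:C)%C = `|a|.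
Proof. by rewrite /= expr0n addr0 sqrtr_sqr. Qed.

Lemma le_opnorm n (S : 'M[C]_n) x : l2norm (S *m x) <= opnorm S * l2norm x.
Proof.
have [x0|x0] := eqVneq (l2norm x) 0.
  by rewrite (l2norm_eq0 x0) mulmx0 l2norm0 mulr0.
have xp : 0 < l2norm x by rewrite lt_def x0 l2norm_ge0.
rewrite -ler_pdivrMr //.
have nE (y : 'cV[C]_n) :
    l2norm ((((l2norm x)^-1)%:C)%C *: y) = l2norm y / l2norm x.
  by rewrite l2normZ modulus_real ger0_norm ?invr_ge0 ?l2norm_ge0 // mulrC.
apply: ub_le_sup; first exact: (opset_has_sup S).2.
exists ((((l2norm x)^-1)%:C)%C *: x); first by rewrite nE divff.
by rewrite -scalemxAr nE.
Qed.

Lemma opnorm_eq0 n (S : 'M[C]_n) : opnorm S = 0 -> S = 0.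
Proof.
move=> S0; have Sx (x : 'cV[C]_n) : S *m x = 0.
  apply: l2norm_eq0; apply/eqP; rewrite eq_le l2norm_ge0 andbT.
  by have := le_opnorm S x; rewrite S0 mul0r.
apply/matrixP => i j; have /matrixP/(_ i ord0) := Sx (delta_mx j ord0).
by rewrite -colE !mxE.
Qed.

Lemma opnormZ n (a : C) (S : 'M[C]_n) : opnorm (a *: S) = modulus a * opnorm S.
Proof.
have Zle b (T : 'M[C]_n) : opnorm (b *: T) <= modulus b * opnorm T.
  apply: opnorm_le; first by rewrite mulr_ge0 ?modulus_ge0 ?opnorm_ge0.
  move=> x; rewrite -scalemxAl l2normZ -mulrA.
  by rewrite ler_wpM2l ?modulus_ge0 ?le_opnorm.
apply/eqP; rewrite eq_le Zle /=.
have [->|a0] := eqVneq a 0; first by rewrite Normc.normc0 mul0r opnorm_ge0.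
have ap : 0 < modulus a.
  rewrite lt_def modulus_ge0 andbT.
  by apply: contra a0 => /eqP/Normc.eq0_normc ->.
have := Zle a^-1 (a *: S); rewrite scalerA mulVf // scale1r Normc.normcV.
by rewrite mulrC ler_pdivlMr // mulrC.
Qed.

Lemma opnormD n (S T : 'M[C]_n) : opnorm (S + T) <= opnorm S + opnorm T.
Proof.
apply: opnorm_le; first by rewrite addr_ge0 ?opnorm_ge0.
move=> x; rewrite mulmxDl mulrDl; apply: le_trans (l2normD _ _) _.
by rewrite lerD ?le_opnorm.
Qed.

Lemma opnormM n (S T : 'M[C]_n) : opnorm (S *m T) <= opnorm S * opnorm T.
Proof.
apply: opnorm_le; first by rewrite mulr_ge0 ?opnorm_ge0.
move=> x; rewrite -mulmxA; apply: le_trans (le_opnorm _ _) _.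
by rewrite -mulrA ler_wpM2l ?opnorm_ge0 ?le_opnorm.
Qed.

Lemma opnorm_delta n (i j : 'I_n) : opnorm (delta_mx i j : 'M[C]_n) <= 1.
Proof.
apply: opnorm_le => // x; rewrite mul1r.
rewrite -(ler_pXn2r (n := 2)) // ?nnegrE ?l2norm_ge0 // [leLHS]l2norm_sqr.
rewrite (bigD1 i) //= big1 => [|k ki]; last first.
  rewrite mxE big1 ?Normc.normc0 ?expr0n // => l _.
  by rewrite mxE (negbTE ki) mul0r.
rewrite addr0 mxE (bigD1 j) //= big1 => [|l lj]; last first.
  by rewrite mxE (negbTE lj) andbF mul0r.
rewrite mxE !eqxx mul1r addr0 ler_pXn2r ?nnegrE ?modulus_ge0 ?l2norm_ge0 //.
exact: modulus_le_l2norm.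
Qed.

Lemma l2norm_col_mx n m (x : 'cV[C]_n) (y : 'cV[C]_m) :
  l2norm (col_mx x y) ^+ 2 = l2norm x ^+ 2 + l2norm y ^+ 2.
Proof.
rewrite !l2norm_sqr big_split_ord /=; congr (_ + _); apply: eq_bigr => i _.
  by rewrite col_mxEu.
by rewrite col_mxEd.
Qed.

Lemma opnorm_dsum0 n m (S : 'M[C]_n) :
  opnorm (block_mx S 0 0 (0 : 'M[C]_m)) = opnorm S.
Proof.
have bE x y : block_mx S 0 0 (0 : 'M_m) *m col_mx x y
    = col_mx (S *m x) (0 : 'cV[C]_m).
  by rewrite mul_block_col !mul0mx !addr0.
have c0 k (z : 'cV[C]_k) : l2norm (col_mx z (0 : 'cV[C]_m)) = l2norm z.
  apply/eqP; rewrite -(eqrXn2 (n := 2)) ?l2norm_ge0 // l2norm_col_mx.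
  by rewrite l2norm0 expr0n addr0.
apply/eqP; rewrite eq_le; apply/andP; split.
  apply: opnorm_le; first exact: opnorm_ge0.
  move=> x; rewrite -[x]vsubmxK bE c0; apply: le_trans (le_opnorm _ _) _.
  rewrite ler_wpM2l ?opnorm_ge0 //.
  rewrite -(ler_pXn2r (n := 2)) // ?nnegrE ?l2norm_ge0 // l2norm_col_mx.
  by rewrite lerDl sqr_ge0.
apply: opnorm_le; first exact: opnorm_ge0.
move=> x; rewrite -[leLHS]c0 -(bE x 0) -[l2norm x]c0.
exact: le_opnorm.
Qed.

Lemma opnorm_is_matrix_norm :
  @is_matrix_norm R R[i]^o (fun n (u : 'M[R[i]]_n) => opnorm u).
Proof.
split.
- exact: opnorm_eq0.
- move=> n a u; rewrite -opnormZ; congr opnorm.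
  by apply/matrixP => i j; rewrite !mxE.
- exact: opnormD.
- exact: opnorm_dsum0.
- move=> n S u; have -> : @lmulmx _ R[i]^o _ S u = S *m u.
    by apply/matrixP => i j; rewrite !mxE.
  exact: opnormM.
- move=> n S u; have -> : @rmulmx _ R[i]^o _ u S = u *m S.
    apply/matrixP => i j; rewrite !mxE; apply: eq_bigr => k _.
    exact: mulrC.
  exact: opnormM.
Qed.

End L2norm.

Definition scalar_mns (R : realType) : matNormedSpace R :=
  MatNormedSpace (opnorm_is_matrix_norm R).

Section HatNorm.
Variable R : realType.
Local Notation C := R[i].

Section General.
Variable E : matNormedSpace R.

Lemma mnormZ n (a : C) (u : 'M[E]_n) :
  mnorm E (map_mx ( *:%R a) u) = modulus a * mnorm E u.
Proof. exact: (matrix_normZ (mnormP E)). Qed.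

Lemma mnormD n (u w : 'M[E]_n) : mnorm E (u + w) <= mnorm E u + mnorm E w.
Proof. exact: (matrix_normD (mnormP E)). Qed.

Lemma mnorm0 n : mnorm E (0 : 'M[E]_n) = 0.
Proof.
have := mnormZ 0 (0 : 'M[E]_n); rewrite Normc.normc0 mul0r => <-.
by congr (mnorm E); apply/matrixP => i j; rewrite !mxE scaler0.
Qed.

Lemma mnorm_ge0 n (u : 'M[E]_n) : 0 <= mnorm E u.
Proof.
have := mnormD u (map_mx ( *:%R (-1)) u); rewrite mnormZ.
have -> : u + map_mx ( *:%R (-1)) u = 0.
  by apply/matrixP => i j; rewrite !mxE scaleN1r subrr.
have -> : modulus (-1 : C) = 1 by rewrite (normcN (1 : C)) Normc.normc1.
by rewrite mnorm0 mul1r -mulr2n pmulrn_lge0.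
Qed.

Lemma mnorm_sum n (I : Type) (s : seq I) (F : I -> 'M[E]_n) :
  mnorm E (\sum_(i <- s) F i) <= \sum_(i <- s) mnorm E (F i).
Proof.
elim: s => [|i s IH]; first by rewrite !big_nil mnorm0.
rewrite !big_cons; apply: le_trans (mnormD _ _) _.
by rewrite lerD2l.
Qed.

Definition single m (a b : 'I_m) (x : E) : 'M[E]_m :=
  \matrix_(i, j) (if (i == a) && (j == b) then x else 0).

Lemma lmul_delta m (a b : 'I_m) (u : 'M[E]_m) :
  lmulmx (delta_mx a b) u = \matrix_(i, j) (if i == a then u b j else 0).
Proof.
apply/matrixP => i j; rewrite !mxE (bigD1 b) //= big1 => [|k kb].
  by rewrite addr0 mxE eqxx andbT; case: eqP; rewrite ?scale1r ?scale0r.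
by rewrite mxE (negbTE kb) andbF scale0r.
Qed.

Lemma rmul_delta m (a b : 'I_m) (u : 'M[E]_m) :
  rmulmx u (delta_mx a b) = \matrix_(i, j) (if j == b then u i a else 0).
Proof.
apply/matrixP => i j; rewrite !mxE (bigD1 a) //= big1 => [|k ka].
  by rewrite addr0 mxE eqxx /=; case: eqP; rewrite ?scale1r ?scale0r.
by rewrite mxE (negbTE ka) scale0r.
Qed.

Lemma mnorm_single_corner m (u : 'M[E]_m) (a b c d : 'I_m) :
  mnorm E (single a b (u c d)) <= mnorm E u.
Proof.
have -> : single a b (u c d) = lmulmx (delta_mx a c) (rmulmx u (delta_mx d b)).
  rewrite lmul_delta rmul_delta; apply/matrixP => i j; rewrite !mxE.
  by case: (i == a).
apply: le_trans (matrix_norm_lmul (mnormP E) _ _) _.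
apply: le_trans (_ : mnorm E (rmulmx u (delta_mx d b)) <= _).
  by rewrite ler_piMl ?mnorm_ge0 ?opnorm_delta.
apply: le_trans (matrix_norm_rmul (mnormP E) _ _) _.
by rewrite ler_piMr ?mnorm_ge0 ?opnorm_delta.
Qed.

Lemma mnorm_single0 m (x : E) :
  mnorm E (single ord0 ord0 x : 'M[E]_m.+1) = mnorm E (const_mx x : 'M[E]_1).
Proof.
rewrite -(matrix_norm_dsum0 (mnormP E) m (const_mx x : 'M[E]_1)).
congr (mnorm E); apply/matrixP => i j.
case: (splitP (i : 'I_(1 + m))) => i' ii'; case: (splitP (j : 'I_(1 + m))) => j' jj'.
- have -> : i = lshift m i' by exact: val_inj.
  have -> : j = lshift m j' by exact: val_inj.
  by rewrite (block_mxEul (const_mx x : 'M_1) 0 0 (0 : 'M_m)) !mxE !ord1.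
- have -> : i = lshift m i' by exact: val_inj.
  have -> : j = rshift 1 j' by exact: val_inj.
  by rewrite (block_mxEur (const_mx x : 'M_1) 0 0 (0 : 'M_m)) !mxE andbF.
- have -> : i = rshift 1 i' by exact: val_inj.
  have -> : j = lshift m j' by exact: val_inj.
  by rewrite (block_mxEdl (const_mx x : 'M_1) 0 0 (0 : 'M_m)) !mxE.
- have -> : i = rshift 1 i' by exact: val_inj.
  have -> : j = rshift 1 j' by exact: val_inj.
  by rewrite (block_mxEdr (const_mx x : 'M_1) 0 0 (0 : 'M_m)) !mxE.
Qed.

Lemma mnorm_single_le n m (a b : 'I_m) (v : 'M[E]_n) (i j : 'I_n) :
  mnorm E (single a b (v i j)) <= mnorm E v.
Proof.
case: m a b => [[]//|m] a b; case: n v i j => [|n] v i j; first by case: i.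
set x := v i j.
have -> : single a b x = single a b ((single ord0 ord0 x : 'M_m.+1) ord0 ord0).
  by rewrite !mxE.
apply: le_trans (mnorm_single_corner _ _ _ _ _) _.
by rewrite mnorm_single0 -(mnorm_single0 n); exact: mnorm_single_corner.
Qed.

Lemma map_phi_single n m (v : 'M[E]_n) (u : 'M['M[C]_n]_m) :
  map_mx (phi v) u = \sum_a \sum_b \sum_i \sum_j
    map_mx ( *:%R (u a b j i)) (single a b (v i j)).
Proof.
apply/matrixP => c d; rewrite mxE summxE (bigD1 c) //= [X in _ + X]big1 ?addr0.
  rewrite summxE (bigD1 d) //= [X in _ + X]big1 ?addr0.
    rewrite summxE; apply: eq_bigr => i _; rewrite summxE.
    by apply: eq_bigr => j _; rewrite !mxE !eqxx.
  move=> b bd; rewrite summxE big1 // => i _; rewrite summxE big1 // => j _.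
  by rewrite !mxE [d == b]eq_sym (negbTE bd) andbF scaler0.
move=> a ac; rewrite summxE big1 // => b _; rewrite summxE big1 // => i _.
rewrite summxE big1 // => j _.
by rewrite !mxE [c == a]eq_sym (negbTE ac) scaler0.
Qed.

End General.

Lemma hat_set_has_sup n m (u : 'M['M[C]_n]_m) : has_sup (hat_set u).
Proof.
split.
  exists (mnorm (scalar_mns R) (map_mx (phi (0 : 'M[scalar_mns R]_n)) u)).
  by exists (scalar_mns R), 0; rewrite mnorm0.
exists (\sum_a \sum_b \sum_i \sum_j modulus (u a b j i)) => _ [E [v [v1 ->]]].
rewrite map_phi_single.
apply: le_trans (mnorm_sum _ _) _; apply: ler_sum => a _.
apply: le_trans (mnorm_sum _ _) _; apply: ler_sum => b _.
apply: le_trans (mnorm_sum _ _) _; apply: ler_sum => i _.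
apply: le_trans (mnorm_sum _ _) _; apply: ler_sum => j _.
rewrite mnormZ ler_piMr //.
  by case: (u a b j i) => x y /=; exact: sqrtr_ge0.
exact: le_trans (mnorm_single_le _ _ _ _ _) v1.
Qed.

Lemma le_hat_norm n m (u : 'M['M[C]_n]_m) (E : matNormedSpace R) (v : 'M[E]_n) :
  mnorm E v <= 1 -> mnorm E (map_mx (phi v) u) <= hat_norm u.
Proof.
move=> v1; apply: ub_le_sup; first exact: (hat_set_has_sup u).2.
by exists E, v.
Qed.

Lemma hat_norm_le n m (u : 'M['M[C]_n]_m) (c : R) :
  (forall (E : matNormedSpace R) (v : 'M[E]_n), mnorm E v <= 1 ->
     mnorm E (map_mx (phi v) u) <= c) -> hat_norm u <= c.
Proof.
move=> uc; apply: ge_sup; first exact: (hat_set_has_sup u).1.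
by move=> _ [E [v [v1 ->]]]; exact: uc.
Qed.

Lemma hat_norm_ge0 n m (u : 'M['M[C]_n]_m) : 0 <= hat_norm u.
Proof.
apply: le_trans (le_hat_norm (E := scalar_mns R) (v := 0) u _).
  exact: mnorm_ge0.
by rewrite mnorm0.
Qed.

Lemma phiD n (E : lmodType C) (v : 'M[E]_n) : {morph phi v : l k / l + k}.
Proof.
move=> l k; rewrite /phi -big_split; apply: eq_bigr => i _.
by rewrite -big_split; apply: eq_bigr => j _; rewrite mxE scalerDl.
Qed.

Lemma phiZ n (E : lmodType C) (v : 'M[E]_n) a l : phi v (a *: l) = a *: phi v l.
Proof.
rewrite /phi scaler_sumr; apply: eq_bigr => i _; rewrite scaler_sumr.
by apply: eq_bigr => j _; rewrite mxE scalerA.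
Qed.

Lemma phi0 n (E : lmodType C) (v : 'M[E]_n) : phi v 0 = 0.
Proof. by rewrite -(scale0r (0 : 'M[C]_n)) phiZ scale0r. Qed.

Lemma phi_sum n (E : lmodType C) (v : 'M[E]_n) (I : Type) (s : seq I)
  (F : I -> 'M[C]_n) : phi v (\sum_(i <- s) F i) = \sum_(i <- s) phi v (F i).
Proof. exact: (big_morph _ (phiD v) (phi0 v)). Qed.

Lemma hat_norm_is_matrix_norm n :
  @is_matrix_norm R 'M[C]_n (fun m (u : 'M['M[C]_n]_m) => hat_norm u).
Proof.
have modulus_ge0 (z : C) : 0 <= modulus z.
  by case: z => a b /=; exact: sqrtr_ge0.
split.
- move=> m u u0; apply/matrixP => a b; rewrite mxE; apply/matrixP => j i.
  rewrite mxE; set v : 'M[scalar_mns R]_n := delta_mx i j : 'M[C]_n.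
  have v1 : mnorm (scalar_mns R) v <= 1 by exact: opnorm_delta.
  have w0 : mnorm (scalar_mns R) (map_mx (phi v) u) = 0.
    by apply/eqP; rewrite eq_le mnorm_ge0 andbT -u0; exact: le_hat_norm.
  have /matrixP/(_ a b) := matrix_norm_eq0 (mnormP (scalar_mns R)) w0.
  rewrite !mxE => <-; rewrite /phi (bigD1 i) //= (bigD1 j) //=.
  rewrite !big1 => [|k ki|k kj].
  + by rewrite !addr0 mxE !eqxx /GRing.scale /= mulr1.
  + rewrite big1 // => l _.
    by rewrite mxE (negbTE ki) /GRing.scale /= mulr0.
  + by rewrite mxE (negbTE kj) andbF /GRing.scale /= mulr0.
- move=> m a u.
  have Zle b (w : 'M['M[C]_n]_m) :
      hat_norm (map_mx ( *:%R b) w) <= modulus b * hat_norm w.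
    apply: hat_norm_le => E v v1.
    have -> : map_mx (phi v) (map_mx ( *:%R b) w)
        = map_mx ( *:%R b) (map_mx (phi v) w).
      by apply/matrixP => i j; rewrite !mxE phiZ.
    by rewrite mnormZ ler_wpM2l // le_hat_norm.
  apply/eqP; rewrite eq_le Zle /=.
  have [->|a0] := eqVneq a 0; first by rewrite Normc.normc0 mul0r hat_norm_ge0.
  have ap : 0 < modulus a.
    rewrite lt_def modulus_ge0 andbT.
    by apply: contra a0 => /eqP/Normc.eq0_normc ->.
  have := Zle a^-1 (map_mx ( *:%R a) u).
  have -> : map_mx ( *:%R a^-1) (map_mx ( *:%R a) u) = u.
    by apply/matrixP => i j; rewrite !mxE scalerA mulVf // scale1r.
  by rewrite Normc.normcV mulrC ler_pdivlMr // mulrC.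
- move=> m u w; apply: hat_norm_le => E v v1.
  have -> : map_mx (phi v) (u + w) = map_mx (phi v) u + map_mx (phi v) w.
    by apply/matrixP => i j; rewrite !mxE phiD.
  by apply: le_trans (mnormD _ _) _; rewrite lerD ?le_hat_norm.
- move=> m k u.
  have bE (E : matNormedSpace R) (v : 'M[E]_n) :
      mnorm E (map_mx (phi v) (block_mx u 0 0 (0 : 'M_k)))
      = mnorm E (map_mx (phi v) u).
    have z p q : map_mx (phi v) (0 : 'M_(p, q)) = 0.
      by apply/matrixP => i j; rewrite !mxE phi0.
    by rewrite map_block_mx !z (matrix_norm_dsum0 (mnormP E)).
  apply/eqP; rewrite eq_le; apply/andP; split; apply: hat_norm_le => E v v1.
    by rewrite bE le_hat_norm.
  by rewrite -bE le_hat_norm.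
- move=> m S u; apply: hat_norm_le => E v v1.
  have -> : map_mx (phi v) (lmulmx S u) = lmulmx S (map_mx (phi v) u).
    apply/matrixP => i j; rewrite !mxE phi_sum; apply: eq_bigr => k _.
    by rewrite phiZ mxE.
  apply: le_trans (matrix_norm_lmul (mnormP E) _ _) _.
  by rewrite ler_wpM2l ?opnorm_ge0 ?le_hat_norm.
- move=> m S u; apply: hat_norm_le => E v v1.
  have -> : map_mx (phi v) (rmulmx u S) = rmulmx (map_mx (phi v) u) S.
    apply/matrixP => i j; rewrite !mxE phi_sum; apply: eq_bigr => k _.
    by rewrite phiZ mxE.
  apply: le_trans (matrix_norm_rmul (mnormP E) _ _) _.
  by rewrite ler_wpM2r ?opnorm_ge0 ?le_hat_norm.
Qed.

End HatNorm.

Definition hatM (R : realType) (n : nat) : matNormedSpace R :=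
  MatNormedSpace (@hat_norm_is_matrix_norm R n).

(* Main.v *)
Require Import Defs.
From mathcomp Require Import all_boot all_order all_algebra.
From mathcomp Require Import reals complex.

(** If [v] is a contraction in block form, then so is its block diagonal part,
    which is the average of [v] and of [S v S] for [S = 1 (+) -1].  Now let [u]
    be the element of M_n(hat M_n) whose image under the amplification of
    [phi v] is [v] itself.  By the above, the block diagonal part of [u] has
    norm at most 1, while each of its two diagonal blocks has norm at least 1,
    so an L^1 identity would give 2 <= 1. *)

Set Implicit Arguments.
Unset Strict Implicit.
Unset Printing Implicit Defensive.

Import Order.TTheory GRing.Theory Num.Theory.
Local Open Scope ring_scope.

Section MatNormedSpace.
Variables (R : realType) (E : matNormedSpace R).
Local Notation C := R[i].

Lemma mnorm_castmx m n (e : m = n) (u : 'M[E]_m) :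
  mnorm E (castmx (e, e) u) = mnorm E u.
Proof. by case: n / e; rewrite castmx_id. Qed.

(** Peeling off both blocks leaves a trailing block whose size is an empty sum; after reassociating
    the blocks, Axiom 1 absorbs it. *)
Lemma mnorm_mxdiag2 (p : 'I_2 -> nat) (u : forall i, 'M[E]_(p i)) :
  mnorm E (\mxdiag_i u i) =
  mnorm E (block_mx (u ord0) 0 0 (u (lift ord0 ord0))).
Proof.
rewrite mxdiag_recl mnorm_castmx mxdiag_recl.
rewrite (eq_mxdiag (B'_ := fun=> 0)); last by case.
(* This cast sits inside a block, out of reach of [mnorm_castmx]; it disappears by eliminating its
   size equation. *)
rewrite mxdiag0; move: mxsize_recl.
case: _ / => /=; rewrite castmx_id.
rewrite -{1}row_mx0 -{1}col_mx0 block_mxA row_mx0 col_mx0.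
by rewrite mnorm_castmx (matrix_norm_dsum0 (mnormP E)).
Qed.

Lemma modulus_sign (b : bool) (x : C) : modulus ((-1) ^+ b * x) = modulus x.
Proof. by case: b; rewrite ?mul1r // expr1 mulN1r (normcN x). Qed.

Lemma opnorm_sign_diag n (s : 'I_n -> bool) :
  opnorm (diag_mx (\row_i (-1) ^+ s i) : 'M[C]_n) <= 1.
Proof.
apply: opnorm_le => // x; rewrite mul1r le_eqVlt; apply/orP; left; apply/eqP.
congr Num.sqrt; apply: eq_bigr => i _.
by rewrite mul_diag_mx !mxE modulus_sign.
Qed.

Lemma lmulmx_diag n (d : 'rV[C]_n) (v : 'M[E]_n) :
  lmulmx (diag_mx d) v = \matrix_(i, j) (d ord0 i *: v i j).
Proof.
apply/matrixP => i j; rewrite !mxE (bigD1 i) //= big1 => [|k ki].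
  by rewrite addr0 mxE eqxx mulr1n.
by rewrite mxE eq_sym (negbTE ki) mulr0n scale0r.
Qed.

Lemma rmulmx_diag n (d : 'rV[C]_n) (v : 'M[E]_n) :
  rmulmx v (diag_mx d) = \matrix_(i, j) (d ord0 j *: v i j).
Proof.
apply/matrixP => i j; rewrite !mxE (bigD1 j) //= big1 => [|k kj].
  by rewrite addr0 mxE eqxx mulr1n.
by rewrite mxE (negbTE kj) mulr0n scale0r.
Qed.

Lemma mnorm_pinching n (s : 'I_n -> bool) (v : 'M[E]_n) :
  mnorm E (\matrix_(i, j) (if s i == s j then v i j else 0)) <= mnorm E v.
Proof.
pose S : 'M[C]_n := diag_mx (\row_i (-1) ^+ s i).
set w := (X in mnorm E X <= _).
(* Entry (i, j) of the right side is [v i j] times 1 + (-1)^(s i + s j), a factor 2 or 0. *)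
have wE : map_mx ( *:%R 2) w = v + lmulmx S (rmulmx v S).
  rewrite lmulmx_diag rmulmx_diag; apply/matrixP => i j.
  rewrite !mxE scalerA -signr_addb; case: (s i) (s j) => [] [] /=;
    by rewrite ?scaleN1r ?scale1r ?subrr ?scaler0 ?scaler_nat ?mulr2n.
have S1 : opnorm S <= 1 by exact: opnorm_sign_diag.
have SvS : mnorm E (lmulmx S (rmulmx v S)) <= mnorm E v.
  apply: le_trans (matrix_norm_lmul (mnormP E) _ _) _.
  apply: le_trans (_ : mnorm E (rmulmx v S) <= _).
    by rewrite ler_piMl ?mnorm_ge0.
  apply: le_trans (matrix_norm_rmul (mnormP E) _ _) _.
  by rewrite ler_piMr ?mnorm_ge0.
have : mnorm E (map_mx ( *:%R 2) w) <= mnorm E v *+ 2.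
  by rewrite wE mulr2n; apply: le_trans (mnormD _ _) _; rewrite lerD2l.
have modulus2 : modulus (2 : C) = 2.
  by rewrite -(rmorph_nat (real_complex R)) modulus_real ger0_norm.
by rewrite mnormZ modulus2 mulr_natl lerMn2r.
Qed.

Lemma mnorm_block_pinching m k (v : 'M[E]_(m + k)) :
  mnorm E (block_mx (ulsubmx v) 0 0 (drsubmx v)) <= mnorm E v.
Proof.
pose s (i : 'I_(m + k)) := if split i is inl _ then true else false.
apply: le_trans (mnorm_pinching s v).
rewrite le_eqVlt; apply/orP; left; apply/eqP; congr (mnorm E).
apply/matrixP => i j; rewrite [RHS]mxE /s.
case: (split_ordP i) => i' ->; case: (split_ordP j) => j' -> /=.
- by rewrite block_mxEul !mxE.
- by rewrite block_mxEur !mxE.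
- by rewrite block_mxEdl !mxE.
- by rewrite block_mxEdr !mxE.
Qed.

End MatNormedSpace.

Section HatNorm.
Variable R : realType.
Local Notation C := R[i].

Lemma modulus_le_opnorm n (S : 'M[C]_n) i j : modulus (S i j) <= opnorm S.
Proof.
have dj : l2norm (delta_mx j ord0 : 'cV[C]_n) <= 1.
  rewrite /l2norm (bigD1 j) //= big1 => [|k kj].
    by rewrite mxE !eqxx addr0 Normc.normc1 expr1n sqrtr1.
  by rewrite mxE (negbTE kj) Normc.normc0 expr0n.
have -> : S i j = (S *m (delta_mx j ord0 : 'cV_n)) i ord0.
  by rewrite -colE mxE.
apply: le_trans (modulus_le_l2norm _ _) _; apply: le_trans (le_opnorm _ _) _.
by rewrite ler_piMr ?opnorm_ge0.
Qed.

Lemma phi_delta (E : lmodType C) n (v : 'M[E]_n) i j :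
  phi v (delta_mx j i) = v i j.
Proof.
rewrite /phi (bigD1 i) //= (bigD1 j) //= !big1 => [|k ki|k kj].
- by rewrite !addr0 mxE !eqxx scale1r.
- by rewrite big1 // => l _; rewrite mxE (negbTE ki) andbF scale0r.
- by rewrite mxE (negbTE kj) scale0r.
Qed.

Lemma phi_delta_scalar n (l : 'M[C]_n) i j :
  phi (delta_mx i j : 'M[C^o]_n) l = l j i.
Proof.
rewrite /phi (bigD1 i) //= (bigD1 j) //= !big1 => [|k ki|k kj].
- by rewrite !addr0 mxE !eqxx /GRing.scale /= mulr1.
- by rewrite big1 // => h _; rewrite mxE (negbTE ki) scaler0.
- by rewrite mxE (negbTE kj) andbF scaler0.
Qed.

(** A matrix unit over the scalar space is an admissible [v] in the supremum, and its [phi v] is a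
    coordinate functional. *)
Lemma modulus_le_hat_norm n m (u : 'M['M[C]_n]_m) a b i j :
  modulus (u a b i j) <= hat_norm u.
Proof.
pose v : 'M[scalar_mns R]_n := delta_mx j i : 'M[C]_n.
have v1 : mnorm (scalar_mns R) v <= 1 by exact: opnorm_delta.
apply: le_trans (le_hat_norm u v1).
have <- : map_mx (phi v) u a b = u a b i j by rewrite mxE phi_delta_scalar.
exact: modulus_le_opnorm.
Qed.

(** The swapped indices cancel the transposition in [phi], so every [v] over any [E] is the image of
    this one matrix. *)
Definition generic_mx n : 'M['M[C]_n]_n := \matrix_(i, j) delta_mx j i.

Lemma map_phi_generic_mx (E : lmodType C) n (v : 'M[E]_n) :
  map_mx (phi v) (generic_mx n) = v.
Proof. by apply/matrixP => i j; rewrite !mxE phi_delta. Qed.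

(** The amplification of [phi v] acts entrywise and so sends this matrix to the block diagonal part
    of [v], a contraction by pinching. *)
Lemma hat_norm_generic_diag m k :
  hat_norm (block_mx (ulsubmx (generic_mx (m + k))) 0
                     0 (drsubmx (generic_mx (m + k)))) <= 1.
Proof.
apply: hat_norm_le => E v v1.
have phi0mx p q : map_mx (phi v) (0 : 'M_(p, q)) = 0.
  by apply/matrixP => i j; rewrite !mxE phi0.
rewrite map_block_mx !phi0mx map_ulsubmx map_drsubmx map_phi_generic_mx.
exact: le_trans (mnorm_block_pinching v) v1.
Qed.

Lemma hat_norm_generic_ul_ge1 m k :
  1 <= hat_norm (ulsubmx (generic_mx (m.+1 + k))).
Proof.
rewrite -(Normc.normc1 R).
pose i0 := lshift k (ord0 : 'I_m.+1).
apply: le_trans (modulus_le_hat_norm _ ord0 ord0 i0 i0).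
by rewrite !mxE !eqxx.
Qed.

Lemma hat_norm_generic_dr_ge1 m k :
  1 <= hat_norm (drsubmx (generic_mx (m + k.+1))).
Proof.
rewrite -(Normc.normc1 R).
pose i0 := rshift m (ord0 : 'I_k.+1).
apply: le_trans (modulus_le_hat_norm _ ord0 ord0 i0 i0).
by rewrite !mxE !eqxx.
Qed.

End HatNorm.

Theorem proposition14 (R : realType) (n : nat) (n_gt1 : (1 < n)%N) :
  ~ is_L1_space (hatM R n).
Proof.
(* The size is now [n.+2], split below as [1 + n.+1], so that both diagonal blocks are nonempty. *)
case: n n_gt1 => [//|[//|n]] _ L1.
set p : 'I_2 -> nat := fun i => if i == ord0 then 1%N else n.+1.
pose w := generic_mx R (1 + n.+1).
pose u (i : 'I_2) : 'M['M[R[i]]_n.+2]_(p i) :=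
  match i == ord0 as b return 'M_(if b then 1 else n.+1)%N with
  | true => ulsubmx w
  | false => drsubmx w
  end.
have := L1 2 p u; rewrite mnorm_mxdiag2 big_ord_recl big_ord1 /= => uE.
(* The norm of [hatM] is [hat_norm] by conversion, so [uE] turns the bound 1 into a bound on the sum
   of the two block norms. *)
have := hat_norm_generic_diag R 1 n.+1; rewrite [X in X <= _]uE.
apply/negP; rewrite -ltNge.
apply: lt_le_trans (lerD (hat_norm_generic_ul_ge1 R 0 n.+1)
                         (hat_norm_generic_dr_ge1 R 1 n)).
by rewrite ltrDl ltr01.
Qed.
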